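(* Let $V$ and $H$ be complex Hilbert spaces, $j\colon V\to H$ a bounded linear map with dense range, and let $a\colon V\times V\to\mathbb{C}$ be a $j$-elliptic form. Let $S$ be a compact linear operator from $V$ into a Banach space $Z$ and let $b_0\colon V\times Z\to\mathbb{C}$ be a bounded sesquilinear form. Define $b(u,v):=b_0(u,Sv)$ for $u,v\in V$. If $j$ is injective on $V(a+b):=\{u\in V: a(u,v)+b(u,v)=0\text{ for all }v\in\ker j\}$, then there exist $\omega'\in\mathbb{R}$ and $\mu'>0$ such that $$\operatorname{Re} a(u,u)+\operatorname{Re} b(u,u)-\omega'\|j(u)\|_H^2\ge\mu'\|u\|_V^2\qquad\text{for all }u\in V(a+b).$$
   Context: A sesquilinear form $a\colon V\times V\to\mathbb{C}$ is called $j$-elliptic if it is continuous and there exist $\omega\in\mathbb{R}$, $\mu>0$ with $\operatorname{Re} a(u,u)-\omega\|j(u)\|_H^2\ge\mu\|u\|_V^2$ for all $u\in V$. *)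

(* Defs.v *)
From HB Require Import structures.
From mathcomp Require Import all_boot all_order all_algebra.
From mathcomp Require Import complex.
From mathcomp Require Import all_classical all_reals all_analysis.

Set Implicit Arguments.
Unset Strict Implicit.
Unset Printing Implicit Defensive.

Import Order.TTheory GRing.Theory Num.Theory.
Import numFieldNormedType.Exports.

Local Open Scope classical_set_scope.
Local Open Scope complex_scope.
Local Open Scope ring_scope.

(* Inner products and sesquilinear forms are linear in the first argument and
   conjugate-linear in the second.  Norms of R[i]-normed spaces are R[i]-valued,
   and z <= w in R[i] means that w - z is real and nonnegative. *)

HB.mixin Record isHilbert (R : realType) (V : Type)
    of CompleteNormedModule R[i] V := {
  inner : {dot V for @Num.conj R[i]} ;
  normr_inner : forall u : V, `|u| ^+ 2 = inner u u
}.

#[short(type="hilbertType")]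
HB.structure Definition Hilbert (R : realType) :=
  {V of isHilbert R V & CompleteNormedModule R[i] V}.

Notation "{ 'sesquilinear' U -> V }" :=
  {bilinear U -> V -> _ | *%R & @Num.conj _ \; *%R}
  (U at level 98, V at level 99, format "{ 'sesquilinear'  U  ->  V }")
  : ring_scope.

Section operators.
Variables (R : realType) (V W : normedModType R[i]).

Definition bounded_op (T : V -> W) :=
  exists M : R, forall u : V, `|T u| <= M%:C * `|u|.

Definition compact_op (T : V -> W) :=
  precompact (T @` [set u : V | `|u| <= 1]).

Definition bounded_form (c : V -> W -> R[i]) :=
  exists M : R, forall (u : V) (w : W), `|c u w| <= M%:C * `|u| * `|w|.

(* R[i]^o is R[i] with its norm topology. *)
Definition continuous_form (c : V -> W -> R[i]) :=
  continuous (fun p : V * W => c p.1 p.2 : R[i]^o).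

End operators.

Section forms.
Variables (R : realType) (V H : hilbertType R) (j : V -> H).

Definition elliptic (c : V -> V -> R[i]) :=
  continuous_form c /\
  exists omega mu : R, 0 < mu /\
    forall u : V,
      'Re (c u u) - omega%:C * `|j u| ^+ 2 >= mu%:C * `|u| ^+ 2.

(* The space V(c) of all u with c(u, v) = 0 for every v in ker j. *)
Definition form_space (c : V -> V -> R[i]) : set V :=
  [set u | forall v : V, j v = 0 -> c u v = 0].

End forms.

(* Main.v *)
(* The heart is a Lions-type inequality on W = V(a+b), a closed subspace on which
   j is injective: for every eps > 0 there is C with
   |S u| <= eps |u| + C |j u| on W.  If it fails, there are unit vectors u_n in W
   with j u_n -> 0 and |S u_n| >= eps, and by compactness S u_n clusters at some
   z <> 0.  The sets of u in W with |u| <= 1, j u small and S u close to z are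
   then nonempty, closed, convex, bounded and decreasing; in a Hilbert space they
   have a common point u, for which j u = 0 and S u = z <> 0, contradicting
   injectivity.  Given the inequality, |b(u,u)| <= M |u| |S u| is absorbed by
   ellipticity through AM-GM. *)

Require Import Defs.
From HB Require Import structures.
From mathcomp Require Import all_boot all_order all_algebra.
From mathcomp Require Import complex.
From mathcomp Require Import ring lra.
From mathcomp Require Import all_classical all_reals all_analysis.

Set Implicit Arguments.
Unset Strict Implicit.
Unset Printing Implicit Defensive.

Import Order.TTheory GRing.Theory Num.Theory.
Import numFieldNormedType.Exports.

Local Open Scope classical_set_scope.
Local Open Scope complex_scope.
Local Open Scope ring_scope.

(** * Real-valued norms and the topology they describe *)

(* The norm of an R[i]-normed space takes values in R[i]; [rnorm] is its
   real-valued version, for which the total order of R is available. *)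
Definition rnorm (R : realType) (V : normedModType R[i]) (u : V) : R :=
  complex.Re `|u|.

Lemma rnormE (R : realType) (V : normedModType R[i]) (u : V) :
  `|u| = (rnorm u)%:C.
Proof. by rewrite /rnorm RRe_real// normr_real. Qed.

Lemma rnorm_ge0 (R : realType) (V : normedModType R[i]) (u : V) : 0 <= rnorm u.
Proof. by rewrite -ler0c -rnormE. Qed.

Lemma rnorm_eq0 (R : realType) (V : normedModType R[i]) (u : V) :
  rnorm u = 0 -> u = 0.
Proof. by move=> u0; apply: normr0_eq0; rewrite rnormE u0. Qed.

Lemma rnorm_gt0 (R : realType) (V : normedModType R[i]) (u : V) :
  u != 0 -> 0 < rnorm u.
Proof.
move=> u0; rewrite lt_neqAle rnorm_ge0 andbT eq_sym.
by apply: contra_neq u0; exact: rnorm_eq0.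
Qed.

Lemma rnorm0 (R : realType) (V : normedModType R[i]) : rnorm (0 : V) = 0.
Proof. by rewrite /rnorm normr0. Qed.

Lemma rnormN (R : realType) (V : normedModType R[i]) (u : V) :
  rnorm (- u) = rnorm u.
Proof. by rewrite /rnorm normrN. Qed.

Lemma rdistC (R : realType) (V : normedModType R[i]) (u v : V) :
  rnorm (u - v) = rnorm (v - u).
Proof. by rewrite /rnorm distrC. Qed.

Lemma rnormD (R : realType) (V : normedModType R[i]) (u v : V) :
  rnorm (u + v) <= rnorm u + rnorm v.
Proof. by rewrite -lecR rmorphD/= -!rnormE ler_normD. Qed.

Lemma rdistD (R : realType) (V : normedModType R[i]) (v u w : V) :
  rnorm (u - w) <= rnorm (u - v) + rnorm (v - w).
Proof. by rewrite -lecR rmorphD/= -!rnormE ler_distD. Qed.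

Lemma rnormZ (R : realType) (V : normedModType R[i]) (k : R) (u : V) :
  rnorm (k%:C *: u) = `|k| * rnorm u.
Proof.
apply: complexI; rewrite -rnormE normrZ rnormE rmorphM/=; congr (_ * _).
by rewrite normc_def/= expr0n/= addr0 sqrtr_sqr.
Qed.

Lemma rnorm_cvgP (R : realType) (V : normedModType R[i]) T (F : set_system T)
    (FF : Filter F) (f : T -> V) (l : V) :
  (f @ F --> l) <-> forall e : R, 0 < e -> \forall x \near F, rnorm (l - f x) < e.
Proof.
split=> [/cvgrPdist_lt fl e e0|fl].
  have /fl : (0 : R[i]) < e%:C by rewrite ltcR.
  by apply: filterS => x; rewrite rnormE ltcR.
(* In [R[i]], [0 < e] forces [e] to be real, so it suffices to test its real part. *)
apply/cvgrPdist_lt => e; rewrite ltcE/= => /andP[/eqP e_real e0].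
apply: filterS (fl _ e0) => x lx.
by rewrite rnormE ltcE/= -e_real eqxx.
Qed.

Lemma nbhs_rball (R : realType) (V : normedModType R[i]) (x : V) (e : R) :
  0 < e -> nbhs x [set y | rnorm (x - y) < e].
Proof. by move: e; apply/(rnorm_cvgP (nbhs_filter x) id x). Qed.

Lemma lipschitz_continuous (R : realType) (V W : normedModType R[i])
    (f : V -> W) (M : R) :
  (forall u v, rnorm (f u - f v) <= M * rnorm (u - v)) -> continuous f.
Proof.
move=> fM x; apply/rnorm_cvgP => e e0.
(* [M] may be zero or negative, so the radius is divided by [|M| + 1]. *)
have M0 : 0 < `|M| + 1 by rewrite ltr_wpDl.
apply: filterS (nbhs_rball x (divr_gt0 e0 M0)) => y /=; rewrite ltr_pdivlMr// => xy.
have := fM x y; have := ler_norm M; have := rnorm_ge0 (x - y); nra.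
Qed.

Lemma closed_rball (R : realType) (V : normedModType R[i]) (z : V) (e : R) :
  closed [set x : V | rnorm (x - z) <= e].
Proof.
move=> x clx; rewrite /= leNgt; apply/negP => ex.
have : nbhs x [set y | rnorm (x - y) < rnorm (x - z) - e].
  by apply: nbhs_rball; rewrite subr_gt0.
move/clx => [y [/= yz xy]]; have := rdistD y x z; lra.
Qed.

Lemma positive_null_sequence (R : realType) : exists e : nat -> R,
  [/\ forall n, 0 < e n, forall m n, (m <= n)%N -> e n <= e m &
  forall d, 0 < d -> exists N, forall n, (N <= n)%N -> e n < d].
Proof.
exists (fun n => n.+1%:R^-1); split=> [n|m n mn|d d0]; first by rewrite invr_gt0.
  by rewrite lef_pV2 ?posrE// ler_nat.
by have [N _ NP] := near_infty_natSinv_lt (PosNum d0); exists N.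
Qed.

(** * Hilbert space geometry and nested convex sets *)

Lemma parallelogram (R : realType) (V : hilbertType R) (u v : V) :
  rnorm (u + v) ^+ 2 + rnorm (u - v) ^+ 2 = 2 * rnorm u ^+ 2 + 2 * rnorm v ^+ 2.
Proof.
apply: complexI; rewrite !rmorphD/= !(rmorphM _ 2)/= !rmorphXn/= -!rnormE !normr_inner.
rewrite dnormD dnormB rmorph_nat; ring.
Qed.

Lemma rnorm_cauchy_cvg (R : realType) (V : completeNormedModType R[i])
    (u_ : nat -> V) :
  (forall e : R, 0 < e -> exists N, forall m n, (N <= m)%N -> (N <= n)%N ->
    rnorm (u_ m - u_ n) < e) ->
  exists l : V, u_ @ \oo --> l.
Proof.
move=> uC; apply/cvg_ex/cauchy_cvgP/cauchy_exP => e; rewrite ltcE/= => /andP[/eqP er e0].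
have [N NP] := uC _ e0; exists (u_ N); exists N => // n /= Nn.
by rewrite -ball_normE /ball_/= rnormE ltcE/= -er eqxx/= NP.
Qed.

(* Near-minimizers of the norm on the [C n] form a Cauchy sequence by the
   parallelogram law. *)
Lemma nested_midpoint_convex (R : realType) (V : hilbertType R)
    (C : nat -> set V) (M : R) :
  (forall n, C n !=set0) -> (forall n, closed (C n)) ->
  (forall m n, (m <= n)%N -> C n `<=` C m) ->
  (forall n u v, C n u -> C n v -> C n ((2^-1)%:C *: (u + v))) ->
  (forall u, C 0%N u -> rnorm u <= M) ->
  \bigcap_n C n !=set0.
Proof.
have [e [e_gt0 _ e_lt]] := positive_null_sequence R.
move=> C0 Ccl Cdec Cmid CM.
(* [A] gathers the lower bounds of |u|^2 on the various [C n], so [sup A] is the limit of the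
   nondecreasing infima. *)
pose A := [set r : R | exists n, forall u, C n u -> r <= rnorm u ^+ 2].
have A_sup : has_sup A.
  split; first by exists 0, 0%N => u _; exact: sqr_ge0.
  exists (M ^+ 2) => r [n rn]; have [u Cu] := C0 n.
  apply: (le_trans (rn _ Cu)).
  have := CM u (Cdec _ _ (leq0n n) _ Cu); have := rnorm_ge0 u; nra.
pose d := sup A.
have near_min k : exists u : V, exists N, [/\ (k <= N)%N, C N u,
    forall v, C N v -> d - e k <= rnorm v ^+ 2 &
    rnorm u ^+ 2 <= d + e k].
  have k0 := e_gt0 k.
  have [r [N rN] dr] := sup_adherent k0 A_sup.
  have [u [Cu ud]] : exists u, C (maxn k N) u /\ rnorm u ^+ 2 <= d + e k.
    (* Otherwise [d + e k] would itself be a lower bound on this set, hence in [A], above its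
       supremum. *)
    apply: contrapT => /forallNP nu.
    suff ? : d + e k <= d by lra.
    apply: ub_le_sup; first by case: A_sup.
    exists (maxn k N) => u Cu; rewrite leNgt; apply/negP => /ltW ud.
    by apply: (nu u).
  exists u, (maxn k N); split=> // [|v Cv]; first exact: leq_maxl.
  rewrite (le_trans (ltW dr))// rN//.
  by apply: Cdec Cv; exact: leq_maxr.
have [u_ u_P] := choice near_min.
have [N_ {u_P}N_P] := choice u_P.
(* The midpoint lies in the larger of the two sets, where |v|^2 is at least [d - e k] or [d - e l];
   in the parallelogram law [d] then cancels. *)
have uC k l : rnorm (u_ k - u_ l) ^+ 2 <= 6 * (e k + e l).
  have [_ Cuk dk uk] := N_P k; have [_ Cul dl ul] := N_P l.
  have -> : rnorm (u_ k - u_ l) ^+ 2 = 2 * rnorm (u_ k) ^+ 2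
      + 2 * rnorm (u_ l) ^+ 2
      - 4 * rnorm ((2^-1)%:C *: (u_ k + u_ l)) ^+ 2.
    by rewrite -parallelogram rnormZ ger0_norm ?invr_ge0//; field.
  have := e_gt0 k; have := e_gt0 l.
  have [kl|/ltnW lk] := leqP (N_ k) (N_ l).
    have := dk _ (Cmid _ _ _ Cuk (Cdec _ _ kl _ Cul)); lra.
  have := dl _ (Cmid _ _ _ (Cdec _ _ lk _ Cuk) Cul); lra.
have [|l ul] := @rnorm_cauchy_cvg R V u_.
  move=> x x0; have x12 : 0 < x ^+ 2 / 12 by rewrite divr_gt0// exprn_gt0.
  have [N NP] := e_lt _ x12.
  exists N => m n /NP Nm /NP Nn; have := uC m n.
  have := rnorm_ge0 (u_ m - u_ n); rewrite ltNge => ? ?; apply/negP; nra.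
exists l => n _; apply: (closed_cvg (C n)) ul => //.
exists n => // k /= nk; have [kN Cu _ _] := N_P k.
by apply: Cdec Cu; exact: leq_trans nk kN.
Qed.

(** * Compact operators *)

(** The images stay in the compact closure of the image of the unit ball. Arbitrarily large indices
    take the place of a subsequence. *)
Lemma compact_op_cluster (R : realType) (V W : normedModType R[i])
    (S : V -> W) (u_ : nat -> V) :
  compact_op S -> (forall n, rnorm (u_ n) <= 1) ->
  exists z, forall n (e : R), 0 < e ->
    exists2 m, (n <= m)%N & rnorm (S (u_ m) - z) < e.
Proof.
rewrite /compact_op precompactE => Sc u1.
have [|z [_ zc]] := Sc ((S \o u_) @ \oo) _.
  exists 0%N => // n _; apply: subset_closure; exists (u_ n) => //=.
  by rewrite rnormE lecR.
exists z => n e e0.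
have Fn : ((S \o u_) @ \oo) ((S \o u_) @` [set m | (n <= m)%N]).
  by exists n => // m nm; exists m.
have [_ [[m /= nm <-] zm]] := zc _ _ Fn (nbhs_rball z e0).
by exists m => //; rewrite rdistC.
Qed.

Lemma rnorm_normalize (R : realType) (V : normedModType R[i]) (u : V) : u != 0 ->
  rnorm ((rnorm u)^-1%:C *: u) = 1.
Proof.
move=> /rnorm_gt0 u0.
by rewrite rnormZ ger0_norm ?invr_ge0 ?rnorm_ge0// mulVf// gt_eqF.
Qed.

Lemma bounded_opP (R : realType) (V W : normedModType R[i]) (T : V -> W) :
  bounded_op T <->
  exists2 M : R, 0 <= M & forall u, rnorm (T u) <= M * rnorm u.
Proof.
split=> [[M TM]|[M _ TM]]; last first.
  by exists M => u; rewrite !rnormE -rmorphM lecR.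
exists `|M| => // u; apply: (le_trans (y := M * rnorm u)).
  by rewrite -lecR rmorphM/= -!rnormE.
by rewrite ler_wpM2r ?rnorm_ge0// ler_norm.
Qed.

Lemma bounded_op_continuous (R : realType) (V W : normedModType R[i])
    (T : {linear V -> W}) : bounded_op T -> continuous T.
Proof.
move=> /bounded_opP[M _ TM]; apply: (@lipschitz_continuous _ _ _ _ M) => u v.
by rewrite -linearB.
Qed.

(** If unbounded, [S] maps some unit-ball vectors [u_ n] to norms above [n], and such images cannot
    cluster. *)
Lemma compact_op_bounded (R : realType) (V W : normedModType R[i])
    (S : {linear V -> W}) : compact_op S -> bounded_op S.
Proof.
move=> Sc.
have [B SB] : exists B : nat, forall u, rnorm u <= 1 -> rnorm (S u) <= B%:R.
  apply: contrapT => /forallNP nB.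
  have u_ex (n : nat) : exists u : V, rnorm u <= 1 /\ n%:R < rnorm (S u).
    apply: contrapT => /forallNP nu; apply: (nB n) => u u1.
    by rewrite leNgt; apply/negP => Su; apply: (nu u).
  have [u_ u_P] := choice u_ex.
  have [z zP] := compact_op_cluster Sc (fun n => (u_P n).1).
  have [m Nm Smz] := zP (Num.truncn (rnorm z + 1)).+1 1 ltr01.
  have [_ mS] := u_P m.
  have zm : rnorm z + 1 < m%:R.
    by rewrite (lt_le_trans (truncnS_gt _))// ler_nat.
  have := rnormD (S (u_ m) - z) z; rewrite subrK => ?; lra.
apply/bounded_opP; exists B%:R => // u.
have [->|u0] := eqVneq u 0; first by rewrite linear0 !rnorm0 mulr0.
have nu0 := rnorm_gt0 u0.
have := SB ((rnorm u)^-1%:C *: u); rewrite rnorm_normalize// => /(_ (lexx 1)).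
rewrite linearZ/= rnormZ ger0_norm ?invr_ge0 ?rnorm_ge0//.
by rewrite ler_pdivrMl// mulrC.
Qed.

(** * The Lions-type inequality *)

(** The one closure condition on [E] gives both scaling ([v = 0]), for normalization, and midpoints
    ([k] one half), for the nested sets. *)
Lemma compact_interpolation (R : realType) (V : hilbertType R)
    (H Z : normedModType R[i]) (j : {linear V -> H}) (S : {linear V -> Z})
    (E : set V) (eps : R) :
  bounded_op j -> compact_op S -> closed E -> E 0 ->
  (forall k u v, E u -> E v -> E (k *: (u + v))) ->
  (forall u, E u -> j u = 0 -> u = 0) -> 0 < eps ->
  exists2 C : R, 0 <= C &
    forall u, E u -> rnorm (S u) <= eps * rnorm u + C * rnorm (j u).
Proof.
move=> jb Sc Ecl E0 Elin Ej eps0.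
have Sb := compact_op_bounded Sc.
have jc := bounded_op_continuous jb; have Scont := bounded_op_continuous Sb.
have /bounded_opP[M M0 SM] := Sb.
have [e [e_gt0 e_dec e_lt]] := positive_null_sequence R.
apply: contrapT => nC.
(* Normalize a violator for the constant [(e n)^-1]: then eps + |j u| / e n < |S u| <= M, which
   yields the last two bounds. *)
have u_ex n : exists u : V, [/\ E u, rnorm u <= 1,
    rnorm (j u) <= M * e n & eps <= rnorm (S u)].
  apply: contrapT => /forallNP nu; apply: nC.
  exists (e n)^-1; first by rewrite invr_ge0 ltW.
  move=> u Eu; rewrite leNgt; apply/negP => Su.
  have u0 : u != 0.
    by apply: contraTneq Su => ->; rewrite !linear0 !rnorm0 !mulr0 addr0 ltxx.
  have nu0 := rnorm_gt0 u0.
  apply: (nu ((rnorm u)^-1%:C *: u)); rewrite rnorm_normalize//.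
  rewrite !linearZ/= !rnormZ ger0_norm ?invr_ge0 ?rnorm_ge0//; split=> //.
  - by rewrite -[u]addr0; exact: Elin.
  - rewrite ler_pdivrMl// mulrA -ler_pdivrMr// [_ / e n]mulrC.
    have := SM u; have : 0 <= eps * rnorm u by rewrite mulr_ge0 ?rnorm_ge0// ltW.
    lra.
  - rewrite ler_pdivlMl// mulrC.
    have : 0 <= (e n)^-1 * rnorm (j u) by rewrite mulr_ge0 ?rnorm_ge0// invr_ge0 ltW.
    lra.
have [u_ u_P] := choice u_ex.
have u1 n : rnorm (u_ n) <= 1 by have [] := u_P n.
have [z zP] := compact_op_cluster Sc u1.
have z0 : 0 < rnorm z.
  have [m _ Smz] := zP 0%N eps eps0; have [_ _ _ Sm] := u_P m.
  have := rnormD (S (u_ m) - z) z; rewrite subrK => ?; lra.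
(* Subtracting 0 gives all three constraints the form [rnorm (x - w) <= r], handled uniformly by
   [closed_rball] and [mid]. *)
pose C n := E `&` [set u : V | rnorm (u - 0) <= 1] `&`
  j @^-1` [set y | rnorm (y - 0) <= M * e n] `&`
  S @^-1` [set y | rnorm (y - z) <= e n].
have [] := @nested_midpoint_convex R V C 1.
- move=> n; have [m nm Smz] := zP n _ (e_gt0 n); have [Em um jm _] := u_P m.
  exists (u_ m); rewrite /C/= !subr0; split; last exact: ltW.
  split=> //; rewrite (le_trans jm)// ler_wpM2l//; exact: e_dec.
- move=> n; apply: closedI; [apply: closedI; [apply: closedI => //|]|].
  + exact: closed_rball.
  + by apply: preimage_closed (@closed_rball _ _ _ _) => x _; exact: jc.
  + by apply: preimage_closed (@closed_rball _ _ _ _) => x _; exact: Scont.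
- move=> m n mn u [[[Eu u1'] ju] Su]; split; last exact: le_trans Su (e_dec _ _ mn).
  split=> //=; apply: (le_trans ju); rewrite ler_wpM2l//; exact: e_dec.
- have mid (W : normedModType R[i]) (x y w : W) (r : R) :
      rnorm (x - w) <= r -> rnorm (y - w) <= r ->
      rnorm ((2^-1)%:C *: (x + y) - w) <= r.
    move=> xr yr.
    have -> : (2^-1)%:C *: (x + y) - w = (2^-1)%:C *: ((x - w) + (y - w)).
      rewrite addrACA -opprD scalerBr; congr (_ - _).
      rewrite -mulr2n -(scaler_nat 2 w) scalerA.
      have -> : (2^-1)%:C * 2%:R = 1 :> R[i].
        by rewrite -(rmorph_nat (real_complex R)) -rmorphM mulVf.
      by rewrite scale1r.
    rewrite rnormZ ger0_norm ?invr_ge0//.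
    have := rnormD (x - w) (y - w); lra.
  move=> n u v [[[Eu u1'] ju] Su] [[[Ev v1] jv] Sv].
  split; [split; [split|]|]; first exact: Elin.
  + exact: mid.
  + by rewrite /= linearZ linearD; exact: mid.
  + by rewrite /= linearZ linearD; exact: mid.
- by move=> u [[[_ /=]]]; rewrite subr0.
move=> u uC.
have null x (c : R) : 0 <= c -> (forall n, x <= c * e n) -> x <= 0.
  move=> c0 xe; rewrite leNgt; apply/negP => x0.
  have c1 : 0 < c + 1 by lra.
  have [N /(_ _ (leqnn N))] := e_lt _ (divr_gt0 x0 c1).
  rewrite ltr_pdivlMr// => ?; have := xe N; have := e_gt0 N; lra.
have Eu : E u by have [[[]]] := uC 0%N I.
have ju : j u = 0.
  apply/rnorm_eq0/eqP; rewrite eq_le rnorm_ge0 andbT; apply: (null _ M) => // n.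
  by have [[_ /=]] := uC n I; rewrite subr0.
(* The common point [u] is 0 by injectivity, so [S u = 0] is within every [e n] of [z]. *)
have : rnorm z <= 0.
  apply: (null _ 1) => // n; have [_ /=] := uC n I.
  by rewrite (Ej u)// linear0 sub0r rnormN mul1r.
lra.
Qed.

(** * The form space and the final estimate *)

Lemma form_space_closed (R : realType) (V H : hilbertType R) (j : V -> H)
    (c : V -> V -> R[i]) :
  (forall v, continuous (fun u => c u v : R[i]^o)) -> closed (form_space j c).
Proof.
move=> cc.
(* The set {0} is written as a closed ball of radius 0, so that the space is an intersection of
   preimages of closed balls. *)
have -> : form_space j c = \bigcap_(v in [set v | j v = 0])
    (fun u => c u v : R[i]^o) @^-1` [set x | rnorm (x - 0) <= 0].
  apply/seteqP; split=> u uE v jv.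
    by rewrite /= subr0 uE// rnorm0.
  apply: (@rnorm_eq0 _ R[i]^o); apply/eqP; rewrite eq_le rnorm_ge0 andbT.
  by have := uE _ jv; rewrite /= subr0.
apply: closed_bigI => v _.
by apply: preimage_closed (@closed_rball _ _ _ _) => x _; exact: cc.
Qed.

Theorem proposition2p8 (R : realType) (V H : hilbertType R)
    (Z : completeNormedModType R[i])
    (j : {linear V -> H}) (a : {sesquilinear V -> V})
    (S : {linear V -> Z}) (b0 : {sesquilinear V -> Z}) :
  let b := fun u v : V => b0 u (S v) in
  bounded_op j -> dense (range j) ->
  elliptic j a ->
  compact_op S ->
  bounded_form b0 ->
  {in form_space j (fun u v => a u v + b u v) &, injective j} ->
  exists omega' mu' : R, 0 < mu' /\
    forall u : V, form_space j (fun u v => a u v + b u v) u ->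
      'Re (a u u) + 'Re (b u u) - omega'%:C * `|j u| ^+ 2
        >= mu'%:C * `|u| ^+ 2.
Proof.
move=> b jb _ [ac [omega [mu [mu0 a_ell]]]] Sc [M0 b0M] j_inj.
pose c u v := a u v + b u v.
pose M := `|M0|.
have bM u w : rnorm (b0 u w : R[i]^o) <= M * rnorm u * rnorm w.
  apply: (le_trans (y := M0 * rnorm u * rnorm w)).
    by rewrite -lecR !rmorphM/= -!rnormE; exact: b0M.
  by rewrite !ler_wpM2r ?rnorm_ge0// ler_norm.
have Ecl : closed (form_space j c).
  apply: form_space_closed => v.
  have av : continuous (fun u => a u v : R[i]^o).
    move=> u; apply: (@continuous_comp _ _ _ (fun u => (u, v))
      (fun p : V * V => a p.1 p.2 : R[i]^o)); last exact: ac.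
    by apply: cvg_pair => //; exact: cvg_cst.
  have bv : continuous (fun u => b u v : R[i]^o).
    apply: (@lipschitz_continuous _ _ _ _ (M * rnorm (S v))) => x y.
    rewrite mulrAC; apply: le_trans (bM _ _).
    by rewrite /b linearBl.
  by move=> u; apply: cvgD; [exact: av|exact: bv].
have E0 : form_space j c 0 by move=> v _; rewrite /c /b !linear0l addr0.
have Elin k u v : form_space j c u -> form_space j c v ->
    form_space j c (k *: (u + v)).
  move=> uE vE w jw; have := uE _ jw; have := vE _ jw; rewrite /c /b => vw uw.
  rewrite !linearZl_LR !linearDl/= -mulrDr addrACA.
  by rewrite uw vw addr0 mulr0.
have Ej u : form_space j c u -> j u = 0 -> u = 0.
  by move=> uE ju; apply: j_inj; rewrite ?inE// ju linear0.
have Mp : 0 <= M by exact: normr_ge0.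
(* Chosen so that [M * eps <= mu / 4]; the [+ 1] covers [M = 0]. *)
have eps0 : 0 < mu / (4 * (M + 1)) by rewrite divr_gt0// mulr_gt0// ltr_wpDl.
have [C C0 SC] := compact_interpolation jb Sc Ecl E0 Elin Ej eps0.
(* Of the coefficient [mu / 2], one [mu / 4] pays for the eps term and the other for the mixed
   term. *)
have absorb u : form_space j c u ->
    rnorm (b u u : R[i]^o) <=
      mu / 2 * rnorm u ^+ 2 + (M * C) ^+ 2 / mu * rnorm (j u) ^+ 2.
  move=> uE; apply: (le_trans (bM _ _)).
  have Meps : M * (mu / (4 * (M + 1))) <= mu / 4.
    by rewrite mulrA ler_pdivrMr ?mulr_gt0 ?ltr_wpDl//; nra.
  (* AM-GM absorbs the mixed term [M C |u| |j u|]. *)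
  have amgm : mu / 4 * rnorm u ^+ 2 + (M * C) ^+ 2 / mu * rnorm (j u) ^+ 2
      - M * C * rnorm u * rnorm (j u)
      = (mu / 2 * rnorm u - M * C * rnorm (j u)) ^+ 2 / mu.
    by field; rewrite gt_eqF.
  have sq0 : 0 <= (mu / 2 * rnorm u - M * C * rnorm (j u)) ^+ 2 / mu.
    by rewrite divr_ge0 ?sqr_ge0// ltW.
  have Mu0 : 0 <= M * rnorm u by rewrite mulr_ge0// rnorm_ge0.
  have := ler_wpM2l Mu0 (SC _ uE).
  have := ler_wpM2r (sqr_ge0 (rnorm u)) Meps.
  lra.
(* What remains of [mu] and [omega] after the bound [absorb] is subtracted from the ellipticity
   estimate. *)
exists (omega - (M * C) ^+ 2 / mu), (mu / 2); split; first by rewrite divr_gt0.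
move=> u uE; have := a_ell u; have := absorb u uE.
rewrite -!complexRe !rnormE -!rmorphXn -!rmorphM -!rmorphB -?rmorphD -?rmorphB !lecR.
have : - complex.Re (b u u) <= rnorm (b u u : R[i]^o).
  rewrite -lecR -rnormE; apply: le_trans (normc_ge_Re _).
  by rewrite lecR -normrN ler_norm.
rewrite /= => ? ? ?; lra.
Qed.
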